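(* Let $\mathfrak{a}=\mathfrak{a}_0\oplus\mathfrak{a}_1$ be a commutative $\mathbb{Z}_2$-graded algebra with product $\cdot$ (so $\mathfrak{a}_i\cdot\mathfrak{a}_j\subset\mathfrak{a}_{i+j}$ and $a\cdot b=(-1)^{\bar a\bar b}\,b\cdot a$ for homogeneous $a,b$), and let $V=\mathfrak{a}$ be the underlying $\mathbb{Z}_2$-graded vector space. Define $m\in\mathfrak{al}^1(V)$ by $$m(x_1,x_2)=\tfrac12\,x_1\cdot x_2,\qquad m(x,y)=x\cdot y,\qquad m(y_1,y_2)=y_1\cdot y_2,$$ for $x,x_1,x_2\in V_0=\mathfrak{a}_0$ and $y,y_1,y_2\in V_1=\mathfrak{a}_1$. Then $[m,m]_{\mathfrak{al}}=0$ if and only if $\mathfrak{a}$ is a Lie antialgebra.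
   Context: Vector spaces are over a field $\mathbb{K}$ of characteristic $0$. A Lie antialgebra is a commutative $\mathbb{Z}_2$-graded algebra $(\mathfrak{a}=\mathfrak{a}_0\oplus\mathfrak{a}_1,\cdot)$ (i.e. $\mathfrak{a}_i\cdot\mathfrak{a}_j\subset\mathfrak{a}_{i+j}$, $a\cdot b=(-1)^{\bar a\bar b}b\cdot a$) satisfying, for all $x,x_i\in\mathfrak{a}_0$ and $y,y_i\in\mathfrak{a}_1$: $x_1\cdot(x_2\cdot x_3)=(x_1\cdot x_2)\cdot x_3$; $x_1\cdot(x_2\cdot y)=\frac12(x_1\cdot x_2)\cdot y$; $x\cdot(y_1\cdot y_2)=(x\cdot y_1)\cdot y_2+y_1\cdot(x\cdot y_2)$; $y_1\cdot(y_2\cdot y_3)+y_2\cdot(y_3\cdot y_1)+y_3\cdot(y_1\cdot y_2)=0$. Let $V=V_0\oplus V_1$ be $\mathbb{Z}_2$-graded. For integers $p,q\ge 0$, a $(p,q)$-linear map is a multilinear map $\varphi:V_0^{\times p}\times V_1^{\times q}\to V$, written $\varphi(x_1,\ldots,x_p;\,y_1,\ldots,y_q)$ with $x_i\in V_0$, $y_j\in V_1$. It is parity preserving if it takes values in $V_0$ when $q$ is even and in $V_1$ when $q$ is odd. Let $\mathfrak{al}^{p,q}(V)$ be the space of parity preserving $(p,q)$-linear maps that are skew-symmetric in the $y$-variables, $\mathfrak{al}(V)=\bigoplus_{p+q\ge 1}\mathfrak{al}^{p,q}(V)$, and $\mathfrak{al}^k(V)=\bigoplus_{p+q=k+1}\mathfrak{al}^{p,q}(V)$,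 $k\ge 0$. The parity of a parity preserving $(p,q)$-linear map $\varphi$ is $\bar\varphi=p+q+1 \pmod 2$. Gerstenhaber product. Let $\varphi$ be a parity preserving $(p,q)$-linear map and $\varphi'$ a parity preserving $(p',q')$-linear map, $p+q\ge1$, $p'+q'\ge 1$. The map $j_\varphi\varphi'$ is defined as follows. (a) If $q=0$: $(j_\varphi\varphi')(x_1,\ldots,x_{p+p'-1};y_1,\ldots,y_{q'})=\sum_{i=0}^{p'-1}(-1)^{i(p+1)}\varphi'(x_1,\ldots,x_i,\varphi(x_{i+1},\ldots,x_{i+p}),x_{i+p+1},\ldots,x_{p+p'-1};y_1,\ldots,y_{q'})$. (b) If $q>0$ is even: $(j_\varphi\varphi')(x_1,\ldots,x_{p+p'-1};y_1,\ldots,y_{q+q'})=(-1)^{(p'-1)(p+1)}\varphi'(x_1,\ldots,x_{p'-1},\varphi(x_{p'},\ldots,x_{p+p'-1};y_1,\ldots,y_q);y_{q+1},\ldots,y_{q+q'})$. (c) If $q$ is odd and $p>0$: $(j_\varphi\varphi')(x_1,\ldots,x_{p+p'};y_1,\ldots,y_{q+q'-1})=(-1)^{p'p}\varphi'(x_1,\ldots,x_{p'};\varphi(x_{p'+1},\ldots,x_{p+p'};y_1,\ldots,y_q),y_{q+1},\ldots,y_{q+q'-1})$. (d) If $q$ is odd and $p=0$: $(j_\varphi\varphi')(x_1,\ldots,x_{p'};y_1,\ldots,y_{q+q'-1})=\sum_{i=0}^{q'-1}\varphi'(x_1,\ldots,x_{p'};y_1,\ldots,y_i,\varphi(y_{i+1},\ldots,y_{i+q}),y_{i+q+1},\ldots,y_{q+q'-1})$.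 In cases (a),(b) the product is $0$ if $p'=0$; in cases (c),(d) it is $0$ if $q'=0$. The Gerstenhaber bracket is $[\varphi,\varphi']=j_\varphi\varphi'-(-1)^{\bar\varphi\,\bar\varphi'}j_{\varphi'}\varphi$, extended bilinearly. The projection $\mathrm{Alt}$ is $(\mathrm{Alt}\,\varphi)(x_1,\ldots,x_p;y_1,\ldots,y_q)=\frac{1}{q!}\sum_{\sigma\in S_q}\mathrm{sign}(\sigma)\,\varphi(x_1,\ldots,x_p;y_{\sigma(1)},\ldots,y_{\sigma(q)})$, and $[\varphi,\varphi']_{\mathfrak{al}}:=\mathrm{Alt}\,[\varphi,\varphi']$ on $\mathfrak{al}(V)$. *)

(* Defs.v *)
From HB Require Import structures.
From mathcomp Require Import all_boot all_order all_fingroup all_algebra.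
From mathcomp Require Import zify.

Set Implicit Arguments.
Unset Strict Implicit.
Unset Printing Implicit Defensive.

Import GRing.Theory.
Local Open Scope ring_scope.

(* A Z/2-graded vector space V = V_0 (+) V_1 is the product V0 * V1 of two    *)
(* K-modules; the degrees 0 and 1 in Z/2 are the booleans false and true,     *)
(* added with (+).                                                            *)
Section Graded.
Variables (K : fieldType) (V0 V1 : lmodType K).
Local Notation V := (V0 * V1)%type.

Definition ev (x : V0) : V := (x, 0).
Definition od (y : V1) : V := (0, y).

Definition homog (i : bool) (v : V) : Prop :=
  if i then v.1 = 0 else v.2 = 0.

Definition graded (mul : V -> V -> V) : Prop :=
  forall (i j : bool) (a b : V),
    homog i a -> homog j b -> homog (i (+) j) (mul a b).

Definition graded_comm (mul : V -> V -> V) : Prop :=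
  forall (i j : bool) (a b : V),
    homog i a -> homog j b -> mul a b = (-1) ^+ (i * j) *: mul b a.

Definition comm_graded_algebra (mul : {bilinear V -> V -> V}) : Prop :=
  graded mul /\ graded_comm mul.

Record lie_antialgebra (mul : {bilinear V -> V -> V}) : Prop := LieAntialgebra {
  la_comm_graded : comm_graded_algebra mul;
  la_assoc : forall x1 x2 x3 : V0,
    mul (ev x1) (mul (ev x2) (ev x3)) = mul (mul (ev x1) (ev x2)) (ev x3);
  la_half : forall (x1 x2 : V0) (y : V1),
    mul (ev x1) (mul (ev x2) (od y))
    = 2%:R^-1 *: mul (mul (ev x1) (ev x2)) (od y);
  la_leibniz : forall (x : V0) (y1 y2 : V1),
    mul (ev x) (mul (od y1) (od y2))
    = mul (mul (ev x) (od y1)) (od y2) + mul (od y1) (mul (ev x) (od y2));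
  la_jacobi : forall y1 y2 y3 : V1,
    mul (od y1) (mul (od y2) (od y3)) + mul (od y2) (mul (od y3) (od y1))
    + mul (od y3) (mul (od y1) (od y2)) = 0 }.

Definition pqmap (p q : nat) : Type := p.-tuple V0 -> q.-tuple V1 -> V.

Definition upd (T : Type) (n : nat) (t : n.-tuple T) (i : 'I_n) (u : T) :
  n.-tuple T := [tuple if j == i then u else tnth t j | j < n].

Definition perm_tuple (T : Type) (n : nat) (s : 'S_n) (t : n.-tuple T) :
  n.-tuple T := [tuple tnth t (s i) | i < n].

Definition multilinear (p q : nat) (f : pqmap p q) : Prop :=
  (forall x y (i : 'I_p), linear (fun u => f (upd x i u) y)) /\
  (forall x y (i : 'I_q), linear (fun u => f x (upd y i u))).

Definition parity_preserving (p q : nat) (f : pqmap p q) : Prop :=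
  forall x y, homog (odd q) (f x y).

Definition skew_symmetric (p q : nat) (f : pqmap p q) : Prop :=
  forall x y (s : 'S_q), f x (perm_tuple s y) = (-1) ^+ s *: f x y.

Definition al_pq (p q : nat) (f : pqmap p q) : Prop :=
  [/\ multilinear f, parity_preserving f & skew_symmetric f].

(* Families of maps of all bidegrees. Elements of the direct sum of the       *)
(* spaces of (p,q)-linear maps, and in particular of al(V), are such families *)
(* with finitely many nonzero components.                                     *)
Definition cochain : Type := forall p q : nat, pqmap p q.

Definition in_al_deg (k : nat) (f : cochain) : Prop :=
  (forall p q, al_pq (f p q)) /\
  (forall p q x y, (p + q)%N != k.+1 -> f p q x y = 0).

(* Evaluation on lists: f is applied when the lists have lengths p and q.     *)
Definition evseq (p q : nat) (f : pqmap p q) (xs : seq V0) (ys : seq V1) : V :=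
  if (insub xs, insub ys) is (Some x, Some y) then f x y else 0.

(* j_f g, as a family concentrated in the bidegree where it lives. The value  *)
(* of a parity preserving f lies in V_0 or V_1 according to the parity of q,  *)
(* and the corresponding component is what gets inserted in g. The four       *)
(* branches are q = 0; q > 0 even; q odd and p > 0; q odd and p = 0.          *)
Definition jprod (p q p' q' : nat) (f : pqmap p q) (g : pqmap p' q') :
  cochain := fun P Q x y =>
  if q == 0%N then
    if [&& 0 < p', P == (p + p' - 1)%N & Q == q']%N then
      \sum_(0 <= i < p') (-1) ^+ (i * (p + 1)) *:
        evseq g (take i x ++ (evseq f (take p (drop i x)) [::]).1 :: drop (i + p) x)
              y
    else 0
  else if ~~ odd q then
    if [&& 0 < p', P == (p + p' - 1)%N & Q == (q + q')%N]%N then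
      (-1) ^+ ((p' - 1) * (p + 1)) *:
        evseq g (take (p' - 1) x ++ [:: (evseq f (drop (p' - 1) x) (take q y)).1])
              (drop q y)
    else 0
  else if (0 < p)%N then
    if [&& 0 < q', P == (p + p')%N & Q == (q + q' - 1)%N]%N then
      (-1) ^+ (p' * p) *:
        evseq g (take p' x) ((evseq f (drop p' x) (take q y)).2 :: drop q y)
    else 0
  else
    if [&& 0 < q', P == p' & Q == (q + q' - 1)%N]%N then
      \sum_(0 <= i < q')
        evseq g x
              (take i y ++ (evseq f [::] (take q (drop i y))).2 :: drop (i + q) y)
    else 0.

Definition bracket_pq (p q p' q' : nat) (f : pqmap p q) (g : pqmap p' q') :
  cochain := fun P Q x y =>
  jprod f g x y - (-1) ^+ ((p + q + 1) * (p' + q' + 1)) *: jprod g f x y.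

(* Bilinear extension of bracket_pq. Bidegrees (p, q) and (p', q') outside    *)
(* the range of summation do not contribute to the component (P, Q): each     *)
(* case of the product with value in bidegree (P, Q) has p, p' <= P + 1 and   *)
(* q, q' <= Q + 1.                                                            *)
Definition bracket (f g : cochain) : cochain := fun P Q x y =>
  \sum_(0 <= p < P.+2) \sum_(0 <= q < Q.+2 | (0 < p + q)%N)
    \sum_(0 <= p' < P.+2) \sum_(0 <= q' < Q.+2 | (0 < p' + q')%N)
      bracket_pq (f p q) (g p' q') x y.

Definition Alt (f : cochain) : cochain := fun p q x y =>
  (q`!)%:R^-1 *: \sum_(s : 'S_q) (-1) ^+ s *: f p q x (perm_tuple s y).

Definition bracket_al (f g : cochain) : cochain := Alt (bracket f g).

Definition mcochain (mul : V -> V -> V) : cochain := fun p q x y =>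
  match tval x, tval y with
  | [:: x1; x2], [::] => 2%:R^-1 *: mul (ev x1) (ev x2)
  | [:: x1], [:: y1] => mul (ev x1) (od y1)
  | [::], [:: y1; y2] => mul (od y1) (od y2)
  | _, _ => 0
  end.

End Graded.

Section Facts.
Variables (K : fieldType) (V0 V1 : lmodType K).
Local Notation V := (V0 * V1)%type.

Fact bracket_pq_range (p q p' q' : nat) (f : pqmap V0 V1 p q)
    (g : pqmap V0 V1 p' q') P Q (x : P.-tuple V0) (y : Q.-tuple V1) :
  (0 < p + q)%N -> (0 < p' + q')%N ->
  ~~ [&& p < P.+2, q < Q.+2, p' < P.+2 & q' < Q.+2]%N ->
  bracket_pq f g x y = 0.
Proof.
have jprod0 a b a' b' (u : pqmap V0 V1 a b) (v : pqmap V0 V1 a' b') :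
    (0 < a + b)%N -> (0 < a' + b')%N ->
    ~~ [&& a < P.+2, b < Q.+2, a' < P.+2 & b' < Q.+2]%N ->
    jprod u v x y = 0.
  move=> ab ab' out; rewrite /jprod.
  case: (eqVneq b 0%N) => [b0|b0].
    by case: ifP => // /and3P[? /eqP ? /eqP ?]; lia.
  case: ifP => ?; first by case: ifP => // /and3P[? /eqP ? /eqP ?]; lia.
  by case: ifP => ?; case: ifP => // /and3P[? /eqP ? /eqP ?]; lia.
move=> pq pq' out; rewrite /bracket_pq !jprod0 ?scaler0 ?subr0 //.
by move: out; apply: contra => /and4P[-> -> -> ->].
Qed.

Variable mul : {bilinear V -> V -> V}.

Let evP : linear (@ev K V0 V1).
Proof. by move=> a u v; congr pair; rewrite /= scaler0 addr0. Qed.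

Let odP : linear (@od K V0 V1).
Proof. by move=> a u v; congr pair; rewrite /= scaler0 addr0. Qed.

Let mcochainE p q (x : p.-tuple V0) (y : q.-tuple V1) :
  mcochain mul x y =
  match p, q with
  | 2, 0 => 2%:R^-1 *: mul (ev V1 (nth 0 x 0)) (ev V1 (nth 0 x 1))
  | 1, 1 => mul (ev V1 (nth 0 x 0)) (od V0 (nth 0 y 0))
  | 0, 2 => mul (od V0 (nth 0 y 0)) (od V0 (nth 0 y 1))
  | _, _ => 0
  end.
Proof.
rewrite /mcochain; case: x y => [xs /= /eqP <-] [ys /= /eqP <-].
by case: xs => [|? [|? [|? ?]]]; case: ys => [|? [|? [|? ?]]].
Qed.

Let nth_upd (W : nmodType) n (t : n.-tuple W) (i : 'I_n) u k (kn : (k < n)%N) :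
  nth 0 (upd t i u) k = if k == i :> nat then u else nth 0 t k.
Proof.
have -> : k = Ordinal kn by [].
by rewrite -!tnth_nth tnth_mktuple (tnth_nth 0).
Qed.

Let nth_perm (W : nmodType) n (t : n.-tuple W) (s : 'S_n) k (kn : (k < n)%N) :
  nth 0 (perm_tuple s t) k = nth 0 t (s (Ordinal kn)).
Proof.
by rewrite -tnth_nth -[LHS](tnth_nth 0 _ (Ordinal kn)) tnth_mktuple.
Qed.

Fact mcochain_in_al_deg1 :
  comm_graded_algebra mul -> in_al_deg 1 (mcochain mul).
Proof.
case=> gr cm; split; last first.
  move=> p q x y; rewrite mcochainE.
  by case: p x => [|[|[|p]]] x; case: q y => [|[|[|q]]] y.
have he (x : V0) : homog false (ev V1 x) by [].
have ho (y : V1) : homog true (od V0 y) by [].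
move=> p q; split.
- split=> x y i a u v; rewrite !mcochainE.
  + case: p x i => [|[|[|p]]] x i; case: q y => [|[|[|q]]] y;
      rewrite ?scaler0 ?addr0 //; first by case: i.
      by rewrite !nth_upd //; case: i => [[|i] ii]//=; rewrite evP linearPl.
    rewrite !nth_upd //; case: i => [[|[|i]] ii]//=; rewrite evP ?linearPl ?linearPr;
    by rewrite scalerDr !scalerA [a * _]mulrC.
  + case: p x => [|[|[|p]]] x; case: q y i => [|[|[|q]]] y i;
      rewrite ?scaler0 ?addr0 //; try by case: i.
      rewrite !nth_upd //; case: i => [[|[|i]] ii]//=;
      by rewrite odP ?linearPl ?linearPr.
    by rewrite !nth_upd //; case: i => [[|i] ii]//=; rewrite odP linearPr.
- move=> x y; rewrite mcochainE.
  case: p x => [|[|[|p]]] x; case: q y => [|[|[|q]]] y;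
    rewrite /homog ?if_same //=; try by case: ifP.
  + exact: (gr true true _ _ (ho _) (ho _)).
  + exact: (gr false true _ _ (he _) (ho _)).
  + by rewrite (gr false false _ _ (he _) (he _)) scaler0.
- move=> x y s; rewrite !mcochainE.
  case: p x => [|[|[|p]]] x; case: q y s => [|[|[|q]]] y s;
    rewrite ?scaler0 //.
  + rewrite !nth_perm.
    have [->|->] : s = 1%g \/ s = tperm ord0 ord_max.
      have s01 : s ord0 != s ord_max by rewrite (inj_eq perm_inj).
      case: (eqVneq (s ord0) ord0) => h; [left|right]; apply/permP => i;
        rewrite ?perm1; apply: val_inj.
        have [->|->] : i = ord0 \/ i = ord_max.
          by case: i => [[|[|i]] ii] //; [left|right]; exact: val_inj.
          by rewrite h.
        move: s01; rewrite h; case: (s ord_max) => [[|[|k]] kk] //.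
      have h' : s ord0 = ord_max.
        by move: h; case: (s ord0) => [[|[|k]] kk] // _; exact: val_inj.
      have [->|->] : i = ord0 \/ i = ord_max.
        by case: i => [[|[|i]] ii] //; [left|right]; exact: val_inj.
        by rewrite tpermL h'.
      rewrite tpermR; move: s01; rewrite h'.
      by case: (s ord_max) => [[|[|k]] kk].
    * by rewrite odd_perm1 expr0 scale1r !perm1.
    * rewrite odd_tperm /= expr1.
      have e0 (k : (0 < 2)%N) : Ordinal k = ord0 :> 'I_2 by exact: val_inj.
      have e1 (k : (1 < 2)%N) : Ordinal k = ord_max :> 'I_2 by exact: val_inj.
      rewrite e0 e1 tpermL tpermR -[X in X *: _]expr1.
      exact: (cm true true _ _ (ho _) (ho _)).
  + have -> : s = 1%g.
      by apply/permP => i; rewrite perm1 !ord1.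
    rewrite odd_perm1 scale1r nth_perm perm1 //.
  + have -> : s = 1%g by apply/permP => -[].
    by rewrite odd_perm1 scale1r.
Qed.

End Facts.

(* Main.v *)
Require Import Defs.
From HB Require Import structures.
From mathcomp Require Import all_boot all_order all_fingroup all_algebra.
From mathcomp Require Import zify.
Import GRing.Theory.
Local Open Scope ring_scope.

(* The cochain m is odd, so [m, m] = 2 j_m m, and it has total arity 2, so    *)
(* [m, m] lives in the bidegrees (3,0), (2,1), (1,2), (0,3). There j_m m is   *)
(*   1/4 ((x1 x2) x3 - x1 (x2 x3)),    1/2 (x1 x2) y - x1 (x2 y),             *)
(*   (x y1) y2 - 1/2 x (y1 y2),        (y1 y2) y3.                            *)
(* Alternating in the y's and using graded commutativity, the last two become *)
(* multiples of the Leibniz and Jacobi defects; each component is thus a      *)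
(* nonzero multiple of the defect of one axiom of Lie antialgebras.           *)

(** As m lives in bidegrees (2,0), (1,1), (0,2), the fourfold sum defining [m, m] collapses to nine
    products, and since m is odd the two halves of the bracket agree ([bracket_mcochain]). Each
    bidegree of arity 3 then holds one or two nested products ([bracket30] to [bracket03]); the
    others vanish ([bracket_arity]). Expanding the signed sums over S_q ([alt_sum0] to [alt_sum3]),
    [bracket_al30] to [bracket_al03] match the vanishing of each component with one axiom,
    characteristic 0 allowing q! and 2 to be cancelled. *)

Lemma sum_perm_lift (W : nmodType) n (F : 'S_n.+1 -> W) :
  \sum_(s : 'S_n.+1) F s
  = \sum_(j < n.+1) \sum_(s : 'S_n) F (lift_perm ord0 j s).
Proof.
(* A permutation is the image j of 0 together with a bijection of the remaining points; injectivity
   and (n+1)! = (n+1) n! make [h] bijective. *)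
pose h (u : 'I_n.+1 * 'S_n) := lift_perm ord0 u.1 u.2.
rewrite pair_big (reindex h) //; apply/onW_bij/inj_card_bij => [[j s] [k t]|].
  move=> /permP e; have jk: j = k by have := e ord0; rewrite !lift_perm_id.
  rewrite -{}jk in e *; congr pair; apply/permP => i.
  by have := e (lift ord0 i); rewrite !lift_perm_lift => /lift_inj.
by rewrite card_prod !card_Sn card_ord factS.
Qed.

(** * Signed sums over small symmetric groups *)

Section AltSum.
Set Implicit Arguments. Unset Strict Implicit.
Variables (K : pzRingType) (W : lmodType K).

(** Laplace expansion along the first entry: moving entry j to the front costs the sign (-1)^j. Sums
    over S_2 and S_3 then follow by recursion, without listing permutations. *)
Lemma alt_sumS (T : Type) n (F : n.+1.-tuple T -> W) (t : n.+1.-tuple T) :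
  \sum_(s : 'S_n.+1) (-1) ^+ s *: F (perm_tuple s t)
  = \sum_(j < n.+1) (-1) ^+ j *: \sum_(s : 'S_n) (-1) ^+ s *:
      F [tuple of tnth t j :: perm_tuple s [tuple tnth t (lift j i) | i < n]].
Proof.
rewrite sum_perm_lift; apply: eq_bigr => j _; rewrite scaler_sumr.
apply: eq_bigr => s _; rewrite scalerA odd_lift_perm /= signr_addb signr_odd.
congr (_ *: F _); apply: eq_from_tnth => i; rewrite tnth_mktuple.
case: (unliftP ord0 i) => [k|] ->; rewrite ?lift_perm_id //.
by rewrite lift_perm_lift tnthS !tnth_mktuple.
Qed.

Lemma alt_sum0 (T : Type) (F : 0.-tuple T -> W) (t : 0.-tuple T) :
  \sum_(s : 'S_0) (-1) ^+ s *: F (perm_tuple s t) = F t.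
Proof.
rewrite (eq_bigl (pred1 1%g)) => [|s].
  by rewrite big_pred1_eq odd_perm1 scale1r tuple0 [t]tuple0.
by apply/esym/eqP/permP => -[].
Qed.

Lemma alt_sum1 (T : Type) (F : 1.-tuple T -> W) (t : 1.-tuple T) :
  \sum_(s : 'S_1) (-1) ^+ s *: F (perm_tuple s t) = F t.
Proof.
rewrite alt_sumS big_ord1 scale1r.
rewrite (alt_sum0 (fun u => F [tuple of tnth t ord0 :: u])).
by congr F; apply: eq_from_tnth => i; rewrite !ord1.
Qed.

Lemma alt_sum2 (T : Type) (F : 2.-tuple T -> W) (y1 y2 : T) :
  \sum_(s : 'S_2) (-1) ^+ s *: F (perm_tuple s [tuple y1; y2])
  = F [tuple y1; y2] - F [tuple y2; y1].
Proof.
rewrite alt_sumS !big_ord_recl big_ord0 addr0 scale1r expr1 scaleN1r.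
do 2!rewrite (alt_sum1 (fun u => F [tuple of tnth _ _ :: u])).
by congr (F _ - F _); apply: val_inj; rewrite /= enum_ordSl enum_ord0.
Qed.

Lemma alt_sum3 (T : Type) (F : 3.-tuple T -> W) (y1 y2 y3 : T) :
  \sum_(s : 'S_3) (-1) ^+ s *: F (perm_tuple s [tuple y1; y2; y3])
  = (F [tuple y1; y2; y3] - F [tuple y1; y3; y2])
    - (F [tuple y2; y1; y3] - F [tuple y2; y3; y1])
    + (F [tuple y3; y1; y2] - F [tuple y3; y2; y1]).
Proof.
have mk2 (f : 'I_2 -> T) : [tuple f i | i < 2] = [tuple f 0; f 1].
  by apply: val_inj; rewrite /= !enum_ordSl enum_ord0 /=; congr [:: _; f _]; apply: val_inj.
rewrite alt_sumS !big_ord_recl big_ord0 addr0 addrA scale1r expr1 scaleN1r.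
rewrite sqrrN expr1n scale1r !mk2.
do 3!rewrite (alt_sum2 (fun u => F [tuple of tnth _ _ :: u])).
by congr (F _ - F _ - (F _ - F _) + (F _ - F _)); apply: val_inj.
Qed.
End AltSum.

(** * Computing [m, m] before alternation *)

Section Bracket.
Set Implicit Arguments. Unset Strict Implicit.
Variables (K : fieldType) (V0 V1 : lmodType K).
Local Notation V := (V0 * V1)%type.

Local Notation arity2 := [:: (0, 2); (1, 1); (2, 0)]%N.

(** The bounds may be too small to reach all three bidegrees; the second hypothesis makes the
    missing terms zero. *)
Lemma sum_arity2 (W : nmodType) (F : nat -> nat -> W) A B :
    (forall p q, (p + q)%N != 2 -> F p q = 0) ->
    (forall p q, (0 < p + q)%N -> ~~ (p < A)%N || ~~ (q < B)%N -> F p q = 0) ->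
  \sum_(0 <= p < A) \sum_(0 <= q < B | (0 < p + q)%N) F p q
  = \sum_(d <- arity2) F d.1 d.2.
Proof.
move=> F0 Fout.
(* Enlarging the bound by 3 guarantees that 0, 1, 2 are in range; the excluded index (0,0)
   contributes 0 anyway. *)
have widen p : \sum_(0 <= q < B | (0 < p + q)%N) F p q = \sum_(0 <= q < B.+3) F p q.
  rewrite big_mkcond [RHS](big_cat_nat (n := B)) //=; last by lia.
  rewrite [X in _ + X]big_nat_cond [X in _ + X]big1 ?addr0 => [|q /andP[/andP[qB _] _]].
    by apply: eq_bigr => q _; case: posnP => // e; rewrite F0 // e.
  by case: (posnP (p + q)) => [e|e]; [rewrite F0 ?e | rewrite Fout // -!leqNgt qB orbT].
under eq_bigr do rewrite widen.
transitivity (\sum_(0 <= p < A.+3) \sum_(0 <= q < B.+3) F p q).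
  rewrite [RHS](big_cat_nat (n := A)) //=; last by lia.
  rewrite [X in _ + X]big_nat_cond [X in _ + X]big1 ?addr0 // => p /andP[/andP[pA _] _].
  apply: big1 => q _.
  by case: (posnP (p + q)) => [e|e]; [rewrite F0 ?e | rewrite Fout // -!leqNgt pA].
have recl3 n (G : nat -> W) : (forall i, G i.+3 = 0) ->
    \sum_(0 <= i < n.+3) G i = G 0%N + G 1%N + G 2.
  by move=> G0; rewrite big_mkord 3!big_ord_recl /= big1 ?addr0 ?addrA // => i _.
rewrite !recl3 => [|q|q|q|p]; try exact: F0; last first.
  by rewrite big1 // => q _; exact: F0.
rewrite (F0 0 0)%N // (F0 0 1)%N // (F0 1 0)%N // (F0 1 2)%N // (F0 2 1)%N // (F0 2 2)%N //.
by rewrite !big_cons big_nil !addr0 !add0r addrA.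
Qed.

(** In all four cases an insertion uses up exactly one argument slot. *)
Lemma jprod_arity (p q p' q' : nat) (f : pqmap V0 V1 p q) (g : pqmap V0 V1 p' q')
    P Q (x : P.-tuple V0) (y : Q.-tuple V1) :
  (p + q + p' + q')%N != (P + Q).+1 -> jprod f g x y = 0.
Proof.
move=> out; rewrite /jprod.
case: eqP => ?; last case: ifP => ?; last case: ifP => ?;
  by case: ifP => // /and3P[? /eqP ? /eqP ?]; move/eqP: out; lia.
Qed.

(** The cochain m on bare lists, so that the concatenations in [jprod] evaluate by computation. *)
Definition mseq (mul : V -> V -> V) (xs : seq V0) (ys : seq V1) : V :=
  match xs, ys with
  | [:: x1; x2], [::] => 2%:R^-1 *: mul (ev V1 x1) (ev V1 x2)
  | [:: x1], [:: y1] => mul (ev V1 x1) (od V0 y1)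
  | [::], [:: y1; y2] => mul (od V0 y1) (od V0 y2)
  | _, _ => 0
  end.

Variable mul : {bilinear V -> V -> V}.
Local Notation m p q := (@mcochain K V0 V1 mul p%N q%N).

Lemma evseq_mcochain p q xs ys :
  evseq (m p q) xs ys
  = if (size xs == p) && (size ys == q) then mseq mul xs ys else 0.
Proof.
rewrite /evseq; case: insubP => [x xp vx|/negPf->//].
case: insubP => [y yq vy|/negPf->]; last by rewrite andbF.
by rewrite xp yq /mcochain vx vy.
Qed.

Lemma mseq_eq0 xs ys : (size xs + size ys)%N != 2 -> mseq mul xs ys = 0.
Proof. by move: xs ys => [|? [|? [|? ?]]] [|? [|? [|? ?]]]. Qed.

(** Needed when the inner factor of a product vanishes: [jprod] still feeds its value 0 to the outer
    map. *)
Lemma mseq_ev0 xs xs' ys : mseq mul (xs ++ 0 :: xs') ys = 0.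
Proof.
have ev0 : ev V1 (0 : V0) = 0 by [].
move: xs xs' ys => [|? [|? [|? ?]]] [|? [|? [|? ?]]] [|? [|? [|? ?]]] //=;
  by rewrite ev0 ?linear0l ?linear0r ?scaler0.
Qed.

Lemma mseq_od0 xs ys ys' : mseq mul xs (ys ++ 0 :: ys') = 0.
Proof.
have od0 : od V0 (0 : V1) = 0 by [].
move: xs ys ys' => [|? [|? [|? ?]]] [|? [|? [|? ?]]] [|? [|? [|? ?]]] //=;
  by rewrite od0 ?linear0l ?linear0r ?scaler0.
Qed.

Lemma evseq_mcochain_eq0 p q xs ys : (p + q)%N != 2 -> evseq (m p q) xs ys = 0.
Proof.
move=> pq; rewrite evseq_mcochain; case: ifP => // /andP[/eqP <- /eqP <-] in pq *.
exact: mseq_eq0.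
Qed.

Lemma jprod_mcochain_eq0 p q p' q' P Q (x : P.-tuple V0) (y : Q.-tuple V1) :
  ((p + q)%N != 2) || ((p' + q')%N != 2) -> jprod (m p q) (m p' q') x y = 0.
Proof.
have in0 xs ys xs' ys' i j :
  ((p + q)%N != 2) || ((p' + q')%N != 2) ->
  evseq (m p' q') (xs ++ (evseq (m p q) xs' ys').1 :: i) ys = 0 /\
  evseq (m p' q') xs (ys ++ (evseq (m p q) xs' ys').2 :: j) = 0.
  case/orP => [pq|pq]; last by rewrite !evseq_mcochain_eq0.
  by rewrite [evseq (m p q) _ _]evseq_mcochain_eq0 //= !evseq_mcochain mseq_ev0 mseq_od0 !if_same.
move=> /in0 {}in0; rewrite /jprod.
case: ifP => _; [|case: ifP => _; [|case: ifP => _]]; case: ifP => // _.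
- by rewrite big1 // => i _; rewrite (in0 _ _ _ _ _ [::]).1 scaler0.
- by rewrite (in0 _ _ _ _ _ [::]).1 scaler0.
- by rewrite (in0 _ [::] _ _ [::] _).2 scaler0.
- by rewrite big1 // => i _; rewrite (in0 _ _ _ _ [::] _).2.
Qed.

Lemma bracket_mcochain P Q (x : P.-tuple V0) (y : Q.-tuple V1) :
  bracket (mcochain mul) (mcochain mul) x y
  = (\sum_(d <- arity2) \sum_(e <- arity2) jprod (m d.1 d.2) (m e.1 e.2) x y) *+ 2.
Proof.
have b0 p q p' q' : ((p + q)%N != 2) || ((p' + q')%N != 2) ->
    bracket_pq (m p q) (m p' q') x y = 0.
  move=> h; rewrite /bracket_pq !jprod_mcochain_eq0 ?scaler0 ?subr0 //.
  by rewrite orbC.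
have inner p q : \sum_(0 <= p' < P.+2) \sum_(0 <= q' < Q.+2 | (0 < p' + q')%N)
      bracket_pq (m p q) (m p' q') x y
    = \sum_(e <- arity2) bracket_pq (m p q) (m e.1 e.2) x y.
  apply: sum_arity2 => p' q' h; first by rewrite b0 ?h ?orbT.
  move=> h'; case: (eqVneq (p + q)%N 2) => pq; last by rewrite b0 ?pq.
  apply: bracket_pq_range; rewrite ?pq //.
  by case/orP: h' => /negPf->; rewrite ?andbF.
rewrite /bracket; under eq_bigr do under eq_bigr do rewrite inner.
rewrite sum_arity2 => [|p q pq|p q pq h]; last 2 first.
- by rewrite big1 // => e _; rewrite b0 ?pq.
- rewrite big1_seq // => e /andP[_ ein]; apply: bracket_pq_range => //.
    by move: e ein; apply/allP.
  by case/orP: h => /negPf->; rewrite ?andbF.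
(* Exchanging the sums in one copy pairs each product with its swap; the bracket sign is -(-1)^(3*3)
   = 1. *)
rewrite mulr2n [X in _ + X]exchange_big -big_split; apply: eq_big_seq => d din.
rewrite -big_split; apply: eq_big_seq => e ein; rewrite /bracket_pq.
have addE (u : nat * nat) : u \in arity2 -> (u.1 + u.2 + 1)%N = 3.
  by move=> uin; apply/eqP; move: u uin; apply/allP.
by rewrite !addE // -signr_odd expr1 scaleN1r opprK.
Qed.

Hypothesis gr : graded mul.

(** [jprod] inserts only one component of the inner value; by the grading, here and in the next two
    lemmas, nothing is lost. *)
Lemma ev_fst_even (x1 x2 : V0) :
  ev V1 (mul (ev V1 x1) (ev V1 x2)).1 = mul (ev V1 x1) (ev V1 x2).
Proof.
have /= := @gr false false (ev V1 x1) (ev V1 x2) erefl erefl.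
by case: (mul _ _) => a b /= ->.
Qed.

Lemma ev_fst_odd (y1 y2 : V1) :
  ev V1 (mul (od V0 y1) (od V0 y2)).1 = mul (od V0 y1) (od V0 y2).
Proof.
have /= := @gr true true (od V0 y1) (od V0 y2) erefl erefl.
by case: (mul _ _) => a b /= ->.
Qed.

Lemma od_snd (x : V0) (y : V1) :
  od V0 (mul (ev V1 x) (od V0 y)).2 = mul (ev V1 x) (od V0 y).
Proof.
have /= := @gr false true (ev V1 x) (od V0 y) erefl erefl.
by case: (mul _ _) => a b /= ->.
Qed.

Lemma evZ (a : K) (x : V0) : ev V1 (a *: x) = a *: ev V1 x.
Proof. by congr pair; rewrite /= scaler0. Qed.

Lemma bracket30 x1 x2 x3 :
  bracket (mcochain mul) (mcochain mul) [tuple x1; x2; x3] [tuple]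
  = (2%:R^-1 *: (2%:R^-1 *: (mul (mul (ev V1 x1) (ev V1 x2)) (ev V1 x3)
              - mul (ev V1 x1) (mul (ev V1 x2) (ev V1 x3))))) *+ 2.
Proof.
rewrite bracket_mcochain !big_cons !big_nil /jprod /= !add0r !addr0.
rewrite big_nat_recl // big_nat1 !evseq_mcochain /=.
rewrite scale1r -signr_odd expr1 scaleN1r !evZ linearZl_LR linearZr_LR /=.
by rewrite !ev_fst_even !scalerBr.
Qed.

(** The terms come from (2,0) inserted in (1,1), and from (1,1) inserted in itself with sign -1. *)
Lemma bracket21 x1 x2 y :
  bracket (mcochain mul) (mcochain mul) [tuple x1; x2] [tuple y]
  = (2%:R^-1 *: mul (mul (ev V1 x1) (ev V1 x2)) (od V0 y)
     - mul (ev V1 x1) (mul (ev V1 x2) (od V0 y))) *+ 2.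
Proof.
rewrite bracket_mcochain !big_cons !big_nil /jprod /= !add0r !addr0.
rewrite big_nat1 !evseq_mcochain /= expr1 scaleN1r scale1r evZ linearZl_LR.
by rewrite ev_fst_even od_snd addrC.
Qed.

(** The terms come from (1,1) inserted in (0,2), and from (0,2) inserted in (2,0), which brings the
    factor 1/2 and the sign -1. *)
Lemma bracket12 x y1 y2 :
  bracket (mcochain mul) (mcochain mul) [tuple x] [tuple y1; y2]
  = (mul (mul (ev V1 x) (od V0 y1)) (od V0 y2)
     - 2%:R^-1 *: mul (ev V1 x) (mul (od V0 y1) (od V0 y2))) *+ 2.
Proof.
rewrite bracket_mcochain !big_cons !big_nil /jprod /= !add0r !addr0.
rewrite !evseq_mcochain /= expr1 scaleN1r scale1r.
by rewrite ev_fst_odd od_snd addrC.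
Qed.

Lemma bracket03 y1 y2 y3 :
  bracket (mcochain mul) (mcochain mul) [tuple] [tuple y1; y2; y3]
  = mul (mul (od V0 y1) (od V0 y2)) (od V0 y3) *+ 2.
Proof.
rewrite bracket_mcochain !big_cons !big_nil /jprod /= !add0r !addr0.
by rewrite !evseq_mcochain /= scale1r ev_fst_odd.
Qed.

Lemma bracket_arity P Q (x : P.-tuple V0) (y : Q.-tuple V1) :
  (P + Q)%N != 3 -> bracket (mcochain mul) (mcochain mul) x y = 0.
Proof.
move=> out; rewrite bracket_mcochain big1 ?mul0rn // => -[p q] _.
apply: big1 => -[p' q'] _ /=.
case: (eqVneq (p + q)%N 2) => pq; last by rewrite jprod_mcochain_eq0 ?pq.
case: (eqVneq (p' + q')%N 2) => pq'; last by rewrite jprod_mcochain_eq0 ?pq' ?orbT.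
by apply: jprod_arity; move/eqP: out; lia.
Qed.

End Bracket.

(** * Alternated components and the axioms *)

Section Components.
Variables (K : fieldType) (V0 V1 : lmodType K).
Local Notation V := (V0 * V1)%type.
Variable mul : {bilinear V -> V -> V}.
Hypothesis charK0 : [pchar K] =i pred0.
Hypothesis cgmul : comm_graded_algebra mul.
Local Notation E := (ev V1).
Local Notation O := (od V0).

Let natr_scale_eq0 n (v : V) : (n.+1%:R^-1 *: v = 0) <-> v = 0.
Proof.
split=> [/eqP|->]; last by rewrite scaler0.
by rewrite scaler_eq0 invr_eq0 (pcharf0P _).1 // => /eqP.
Qed.

Let mulrn_eq0V n (v : V) : (v *+ n.+1 = 0) <-> v = 0.
Proof.
split=> [/eqP|->]; last by rewrite mul0rn.
by rewrite -scaler_nat scaler_eq0 (pcharf0P _).1 // => /eqP.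
Qed.

Let gr : graded mul := cgmul.1.

Lemma mul_odC (y y' : V1) : mul (O y) (O y') = - mul (O y') (O y).
Proof. by rewrite (cgmul.2 true true) // expr1 scaleN1r. Qed.

Lemma mul_ev_odC (x : V0) (y : V1) : mul (E x) (O y) = mul (O y) (E x).
Proof. by rewrite (cgmul.2 false true) // scale1r. Qed.

Lemma bracket_al30 x1 x2 x3 :
  bracket_al (mcochain mul) (mcochain mul) [tuple x1; x2; x3] [tuple] = 0 <->
  mul (E x1) (mul (E x2) (E x3)) = mul (mul (E x1) (E x2)) (E x3).
Proof.
rewrite /bracket_al /Alt (alt_sum0 (fun t => bracket _ _ _ t)) bracket30 //.
rewrite natr_scale_eq0 mulrn_eq0V !natr_scale_eq0.
by split=> [/subr0_eq|->]; rewrite ?subrr.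
Qed.

Lemma bracket_al21 x1 x2 y :
  bracket_al (mcochain mul) (mcochain mul) [tuple x1; x2] [tuple y] = 0 <->
  mul (E x1) (mul (E x2) (O y)) = 2%:R^-1 *: mul (mul (E x1) (E x2)) (O y).
Proof.
rewrite /bracket_al /Alt (alt_sum1 (fun t => bracket _ _ _ t)) bracket21 //.
rewrite natr_scale_eq0 mulrn_eq0V.
by split=> [/subr0_eq|->]; rewrite ?subrr.
Qed.

Lemma bracket_al12 x y1 y2 :
  bracket_al (mcochain mul) (mcochain mul) [tuple x] [tuple y1; y2] = 0 <->
  mul (E x) (mul (O y1) (O y2))
  = mul (mul (E x) (O y1)) (O y2) + mul (O y1) (mul (E x) (O y2)).
Proof.
rewrite /bracket_al /Alt (alt_sum2 (fun t => bracket _ _ _ t)) !bracket12 //.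
rewrite natr_scale_eq0 -mulrnBl mulrn_eq0V.
rewrite [mul (O y2) (O y1)]mul_odC linearNr scalerN opprK.
(* As x y2 is odd, (x y2) y1 = - y1 (x y2); with y2 y1 = - y1 y2, the two halves of x (y1 y2) add up
   to the Leibniz defect. *)
rewrite -[mul (E x) (O y2)](od_snd gr) [mul (O (_).2) _]mul_odC (od_snd gr).
have half2 : 2%:R^-1 + 2%:R^-1 = 1 :> K.
  by rewrite -[RHS](@divff _ 2%:R) ?(pcharf0P _).1 // mulrDl mul1r.
rewrite opprD opprK addrACA -opprD -scalerDl half2 scale1r.
by split=> [/subr0_eq|->]; rewrite ?subrr.
Qed.

Lemma bracket_al03 y1 y2 y3 :
  bracket_al (mcochain mul) (mcochain mul) [tuple] [tuple y1; y2; y3] = 0 <->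
  mul (O y1) (mul (O y2) (O y3)) + mul (O y2) (mul (O y3) (O y1))
  + mul (O y3) (mul (O y1) (O y2)) = 0.
Proof.
rewrite /bracket_al /Alt (alt_sum3 (fun t => bracket _ _ _ t)) !bracket03 //.
rewrite natr_scale_eq0 -!mulrnBl -mulrnDl mulrn_eq0V.
(* A product of two odd elements is even, hence commutes with the third. *)
have T a b c : mul (mul (O a) (O b)) (O c) = mul (O c) (mul (O a) (O b)).
  by rewrite -(ev_fst_odd gr) mul_ev_odC.
rewrite !T [mul (O y1) (O y3)]mul_odC [mul (O y2) (O y1)]mul_odC.
rewrite [mul (O y3) (O y2)]mul_odC !linearNr !opprK -opprD opprK.
(* The six terms regroup into two copies of the cyclic sum. *)
rewrite [X in X = 0 <-> _](AC (2*2*2) ((4*2*1)*(6*5*3))) /= -mulr2n.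
exact: mulrn_eq0V.
Qed.

End Components.

Theorem proposition5p3 (K : fieldType) (charK0 : [pchar K] =i pred0)
    (V0 V1 : lmodType K)
    (mul : {bilinear (V0 * V1)%type -> (V0 * V1)%type -> (V0 * V1)%type})
    (mul_comm_graded : comm_graded_algebra mul) :
  (forall (p q : nat) (x : p.-tuple V0) (y : q.-tuple V1),
     bracket_al (mcochain mul) (mcochain mul) x y = 0)
  <-> lie_antialgebra mul.
Proof.
split=> [mm0 | [_ assoc half leibniz jacobi] p q x y].
  split=> // *.
  - exact/bracket_al30.
  - exact/bracket_al21.
  - exact/bracket_al12.
  - exact/bracket_al03.
case: (eqVneq (p + q)%N 3) => [pq|pq]; last first.
  by rewrite /bracket_al /Alt big1 ?scaler0 // => s _; rewrite bracket_arity ?scaler0.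
case: p q pq x y => [|[|[|[|p]]]] [|[|[|[|q]]]] // _ x y.
- case/tupleP: y => y1 y; case/tupleP: y => y2 y; case/tupleP: y => y3 y.
  by rewrite (tuple0 x) (tuple0 y); exact/bracket_al03.
- case/tupleP: x => x1 x; case/tupleP: y => y1 y; case/tupleP: y => y2 y.
  by rewrite (tuple0 x) (tuple0 y); exact/bracket_al12.
- case/tupleP: x => x1 x; case/tupleP: x => x2 x; case/tupleP: y => y1 y.
  by rewrite (tuple0 x) (tuple0 y); exact/bracket_al21.
- case/tupleP: x => x1 x; case/tupleP: x => x2 x; case/tupleP: x => x3 x.
  by rewrite (tuple0 x) (tuple0 y); exact/bracket_al30.
Qed.
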